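(* Let $G$ be a graph without isolated vertices that is not a star, and let $\mathfrak{F}(\neg G)$ be the family of all finite graphs without isolated vertices, except $G$. If (i) either $G$ is non-complete and $p\ge |G|$, (ii) or $G$ is complete and $p>|G|$, then $f(n,K_p|\mathfrak{F}(\neg G))=1$ holds for every $n$ sufficiently large with respect to $p$.
   Context: $|G|$ is the number of vertices of $G$. Stars are the graphs $K_{1,r}$, $r\ge1$ (so $K_2$ is a star). In an edge coloring of $K_n$ (not necessarily proper), for a copy $H'\subseteq K_n$ of a graph $H$, a color class of $H'$ is the graph (without isolated vertices) formed by all edges of $H'$ having a given color that occurs in $H'$. For a family $\mathcal{F}$ of graphs (closed under isomorphism) with $K_2\in\mathcal{F}$, and $n\ge |H|$, $f(n,H|\mathcal{F})$ is the smallest integer $m$ such that in every edge coloring of $K_n$ using at least $m$ colors there exists a copy of $H$ in which all color classes are members of $\mathcal{F}$ (the smallest possible value being $1$, meaning that every edge coloring of $K_n$ has such a copy). *)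

(* Defs.v *)
(* Built on Mathematical Components; mathcomp.classical is used only to turn a
   predicate on nat into a boolean one, so that its minimum can be taken. *)
From HB Require Import structures.
From mathcomp Require Import all_boot.
From mathcomp Require Import boolp.

Set Implicit Arguments.
Unset Strict Implicit.
Unset Printing Implicit Defensive.

Record sgraph := SGraph {
  vertex :> finType;
  adj : rel vertex;
  adj_sym : symmetric adj;
  adj_irrefl : irreflexive adj
}.

Definition isomorphic (G H : sgraph) : Prop :=
  exists2 f : G -> H, bijective f & forall x y, adj (f x) (f y) = adj x y.

Definition no_isolated (G : sgraph) : Prop := forall x : G, exists y, adj x y.

Definition is_complete (G : sgraph) : Prop :=
  forall x y : G, x != y -> adj x y.

Fact complete_sym n : symmetric (fun x y : 'I_n => x != y).
Proof. by move=> x y; rewrite eq_sym. Qed.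

Fact complete_irrefl n : irreflexive (fun x y : 'I_n => x != y).
Proof. by move=> x; rewrite eqxx. Qed.

Definition complete (n : nat) : sgraph :=
  SGraph (@complete_sym n) (@complete_irrefl n).

Definition is_left (A B : Type) (x : A + B) : bool :=
  if x is inl _ then true else false.

Fact complete_bipartite_sym a b :
  symmetric (fun x y : 'I_a + 'I_b => is_left x != is_left y).
Proof. by move=> x y; rewrite eq_sym. Qed.

Fact complete_bipartite_irrefl a b :
  irreflexive (fun x y : 'I_a + 'I_b => is_left x != is_left y).
Proof. by move=> x; rewrite eqxx. Qed.

Definition complete_bipartite (a b : nat) : sgraph :=
  SGraph (@complete_bipartite_sym a b) (@complete_bipartite_irrefl a b).

Definition is_star (G : sgraph) : Prop :=
  exists2 r, 0 < r & isomorphic G (complete_bipartite 1 r).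

Definition edges (G : sgraph) : {set {set G}} :=
  [set [set xy.1; xy.2] | xy in [set xy : G * G | adj xy.1 xy.2]].

Fact span_sym (V : finType) (E : {set {set V}}) :
  symmetric (fun x y : {x : V | x \in cover E} =>
    (val x != val y) && ([set val x; val y] \in E)).
Proof. by move=> x y; rewrite eq_sym setUC. Qed.

Fact span_irrefl (V : finType) (E : {set {set V}}) :
  irreflexive (fun x y : {x : V | x \in cover E} =>
    (val x != val y) && ([set val x; val y] \in E)).
Proof. by move=> x; rewrite eqxx. Qed.

(* The vertices are the endpoints of the edges in E only, so that no vertex is
   isolated when E consists of two-element sets. *)
Definition span (V : finType) (E : {set {set V}}) : sgraph :=
  SGraph (@span_sym V E) (@span_irrefl V E).

(* An edge coloring of K_n is given by a function on all subsets of 'I_n; only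
   its values on [edges (complete n)] are ever used. Since these are finitely
   many, taking colors in nat is no restriction. *)
Definition coloring (n : nat) := {set complete n} -> nat.

Definition colors_on (n : nat) (c : coloring n) (E : {set {set complete n}}) :
  seq nat := undup [seq c e | e <- enum E].

Definition num_colors (n : nat) (c : coloring n) : nat :=
  size (colors_on c (edges (complete n))).

(* A copy of H in K_n is the image of H under an injection of its vertices. *)
Definition copy_edges (n : nat) (H : sgraph) (phi : H -> complete n) :
  {set {set complete n}} := [set phi @: (e : {set H}) | e in edges H].

Definition color_class (n : nat) (c : coloring n) (E : {set {set complete n}})
  (i : nat) : sgraph := span [set e in E | c e == i].

Definition has_good_copy (n : nat) (H : sgraph) (F : sgraph -> Prop)
  (c : coloring n) : Prop :=
  exists2 phi : H -> complete n, injective phi &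
    forall i, i \in colors_on c (copy_edges phi) ->
      F (color_class c (copy_edges phi) i).

Definition forces (n : nat) (H : sgraph) (F : sgraph -> Prop) (m : nat) : Prop :=
  forall c : coloring n, m <= num_colors c -> has_good_copy H F c.

(* With more colors than edges, [forces] holds vacuously. *)
Fact ex_forces n H F : exists m, (0 < m) && `[< forces n H F m >].
Proof.
exists #|edges (complete n)|.+1; apply/andP; split=> //; apply/asboolP => c.
rewrite /num_colors /colors_on ltnNge.
by rewrite (leq_trans (size_undup _)) // size_map -cardE.
Qed.

(* f(n, H | F); meaningful for #|H| <= n and F an isomorphism-closed family
   containing K_2. *)
Definition f (n : nat) (H : sgraph) (F : sgraph -> Prop) : nat :=
  ex_minn (ex_forces n H F).

Definition all_but (G X : sgraph) : Prop := no_isolated X /\ ~ isomorphic X G.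

Lemma isomorphic_sym G H : isomorphic G H -> isomorphic H G.
Proof.
case=> g [g' gK g'K] gE; exists g'; first by exists g.
by move=> x y; rewrite -gE !g'K.
Qed.

Lemma isomorphic_trans G H K :
  isomorphic G H -> isomorphic H K -> isomorphic G K.
Proof.
case=> g gB gE [h hB hE]; exists (h \o g); first exact: bij_comp.
by move=> x y /=; rewrite hE gE.
Qed.

Lemma all_but_iso G X Y : isomorphic X Y -> all_but G X -> all_but G Y.
Proof.
move=> XY [Xni XG]; split=> [y | YG]; last exact/XG/(isomorphic_trans XY).
have [h [h' hK h'K] hE] := XY; have [x hx] := Xni (h' y).
by exists (h x); rewrite -(h'K y) hE.
Qed.

Lemma all_but_K2 G : ~ is_star G -> all_but G (complete 2).
Proof.
move=> Gstar; split=> [x | K2G].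
  by exists (rev_ord x); case: x => [[|[|//]] ?].
apply: Gstar; exists 1 => //; apply: isomorphic_trans (isomorphic_sym K2G) _.
exists (fun x : 'I_2 => if x == ord0 then inl ord0 else inr ord0).
  exists (fun x : 'I_1 + 'I_1 => if is_left x then ord0 else ord_max).
    by case=> [[|[|//]] ?]; apply/val_inj.
  by case=> x; rewrite (ord1 x).
by do 2!case=> [[|[|//]] ?].
Qed.

(* Main.v *)
Require Import Defs.
From mathcomp Require Import all_boot.
From mathcomp Require Import boolp.

(** Every edge coloring of a large K_n contains a K_p which is monochromatic or
    in which every color class is a star. This is the part of the Erdos-Rado
    canonical Ramsey theorem that matters here: of its unavoidable patterns, the
    rainbow and lexical ones have only stars as color classes. Such a K_p is the
    required copy. Its color classes are not isomorphic to G if they are stars,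
    since G is not one; and the only class of a monochromatic K_p is K_p itself,
    which differs from G because G is either non-complete or has fewer than p
    vertices. As this works for every coloring, f takes its least value 1.

    The star case is reached through orderings in which every vertex is joined
    to the vertices placed before it by colors that do not occur among those
    ([fresh]): each color is then introduced by one vertex, which is the center
    of its class ([fresh_centered]). Such an ordering is found as follows. For a
    set S of vertices, call the number of vertices of S joined to v by the color
    i the degree of v in the color i.
    - If all these degrees are small compared with S, few vertices are unsuitable
      as the next one and a fresh ordering is built greedily ([greedy_fresh]).
    - Otherwise some v has many neighbors in one color i. Record (v, i) and go on
      inside this neighborhood. Unless the first case occurs at some stage, this
      gives a long sequence in which the color of an edge is the label of its
      earlier end ([fresh_or_determined]). By the pigeonhole principle, p of the
      vertices have a common label, and are then monochromatic, or p of them have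
      distinct labels, and then form a fresh ordering when read backwards
      ([monochromatic_or_fresh]). *)

Set Implicit Arguments.
Unset Strict Implicit.
Unset Printing Implicit Defensive.

(** * Counting *)

Lemma card_bigcup_leq (I T : finType) (A : {set I}) (F : I -> {set T}) m :
  (forall i, i \in A -> #|F i| <= m) -> #|\bigcup_(i in A) F i| <= #|A| * m.
Proof.
move=> Fm; rewrite -sum_nat_const.
elim/big_rec2: _ => [|i k B iA Bk]; first by rewrite cards0.
by apply: leq_trans (leq_card_setU _ _) _; rewrite leq_add ?Fm.
Qed.

(** The pigeonhole principle, with the values of [s] as pigeonholes. *)
Lemma size_undup_count (K : eqType) (s : seq K) m :
  (forall i, i \in s -> count_mem i s <= m) -> size s <= size (undup s) * m.
Proof.
move=> sm; rewrite -(perm_size (perm_count_undup s)) size_flatten /shape -map_comp.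
have {sm} : {in undup s, forall i, count_mem i s <= m}.
  by move=> i; rewrite mem_undup; apply: sm.
elim: (undup s) => //= i u IH um; rewrite size_nseq mulSn leq_add ?um ?mem_head //.
by apply: IH => j ju; rewrite um // inE ju orbT.
Qed.

(** * Orderings with fresh colors and with determined colors *)

Section Ramsey.
Variables (T : finType) (K : eqType) (c : {set T} -> K).

(** The vertices are listed from the last one placed to the first, so the new
    colors are those from the head to the tail. These may repeat, unlike in a
    rainbow clique: a bound on color degrees limits how many vertices repeat an
    old color, but not how many are joined to two given vertices by one color. *)
Fixpoint fresh (s : seq T) : Prop :=
  if s is w :: s' then
    [/\ w \notin s', fresh s' &
        forall x y z, x \in s' -> y \in s' -> z \in s' -> y != z ->
          c [set w; x] != c [set y; z]]
  else True.

(** A color that does not occur inside a nonempty [s] qualifies as well; with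
    this convention the tail of a fresh ordering can be treated by induction for
    every color. *)
Definition centered (s : seq T) i := exists2 w, w \in s &
  forall x y, x \in s -> y \in s -> x != y -> c [set x; y] = i ->
    x = w \/ y = w.

Definition monochromatic (s : seq T) := exists i,
  forall x y, x \in s -> y \in s -> x != y -> c [set x; y] = i.

Lemma fresh_uniq s : fresh s -> uniq s.
Proof. by elim: s => //= w s IH [-> /IH->]. Qed.

Lemma fresh_take p s : fresh s -> fresh (take p s).
Proof.
elim: s p => [|w s IH] [|p] //= [ws /(IH p) ps h]; split=> //.
  by apply: contra ws; apply: mem_take.
by move=> x y z /mem_take xs /mem_take ys /mem_take zs; apply: h.
Qed.

(** A color used from the head to the tail does not occur inside the tail, so the
    head is its center; any other color has its center in the tail. *)
Lemma fresh_centered s i : 0 < size s -> fresh s -> centered s i.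
Proof.
elim: s => //= w s IH _ [ws fs h].
case: (boolP (has (fun x => c [set w; x] == i) s)) => [/hasP[x xs /eqP <-]|].
  exists w; rewrite ?mem_head // => y z; rewrite !inE.
  case/predU1P=> [-> | ys]; first by left.
  case/predU1P=> [-> | zs]; first by right.
  by move=> yz /esym E; have := h x y z xs ys zs yz; rewrite E eqxx.
move/hasPn=> wi; case: s => [|u s] in IH ws fs h wi *.
  by exists w; rewrite ?mem_head // => x y; rewrite !inE => /eqP-> /eqP->; left.
have [//|//|v vs hv] := IH; exists v; first by rewrite inE vs orbT.
move=> x y; rewrite ![_ \in w :: _]inE.
case/predU1P=> [-> | xs]; case/predU1P=> [-> | ys]; first by rewrite eqxx.
- by move=> _ E; have := wi _ ys; rewrite E eqxx.
- by move=> _ E; have := wi _ xs; rewrite setUC E eqxx.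
- exact: hv.
Qed.

(** A vertex w outside a fresh sequence s cannot be added only if c(wx) = c(yz)
    for some x, y, z in s. Each of the at most p^3 triples excludes at most d
    vertices, because d bounds the degree of x in the color c(yz); the summand p
    accounts for the vertices of s. *)
Lemma greedy_fresh (S : {set T}) d p :
    (forall v i, v \in S -> #|[set w in S | (w != v) && (c [set w; v] == i)]| <= d) ->
    p + p ^ 3 * d <= #|S| ->
  exists s, [/\ size s = p, {subset s <= S} & fresh s].
Proof.
move=> deg; elim: p => [|p IH] pS; first by exists [::].
have [|s [sp sS fs]] := IH.
  by apply: leq_trans pS; rewrite leq_add // leq_mul // leq_exp2r.
pose A := [set x in s]; have Ap : #|A| <= p by rewrite -sp cardsE card_size.
(* All vertices of [S] that cannot be added to [s] are in [B]. *)
pose B := A :|: \bigcup_(x in A) \bigcup_(y in A) \bigcup_(z in A)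
  [set w in S | (w != x) && (c [set w; x] == c [set y; z])].
have [w wS wB] : exists2 w, w \in S & w \notin B.
  apply/subsetPn/negP => /subset_leq_card; rewrite leqNgt => /negP; apply.
  apply: leq_ltn_trans (leq_card_setU _ _) _.
  apply: leq_trans pS; rewrite addSn ltnS.
  apply: (@leq_trans (p + p ^ 3 * d)); last first.
    by rewrite leq_add // leq_mul // leq_exp2r.
  rewrite leq_add // (expnS _ 2) (expnS _ 1) expn1 -!mulnA.
  have step (F : T -> {set T}) m :
      (forall i, i \in A -> #|F i| <= m) -> #|\bigcup_(i in A) F i| <= p * m.
    by move=> h; apply: leq_trans (card_bigcup_leq h) _; rewrite leq_mul.
  apply: (step) => x xA; apply: (step) => y yA; apply: (step) => z zA.
  by apply: deg; apply: sS; rewrite inE in xA.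
exists (w :: s); split=> /=; first by rewrite sp.
  by move=> x; rewrite inE => /predU1P[-> | /sS].
have ws : w \notin s by apply: contra wB => ws; rewrite !inE ws.
split=> // x y z xs ys zs yz; apply: contra wB => E.
rewrite inE; apply/orP; right.
apply/bigcupP; exists x; rewrite ?inE //; apply/bigcupP; exists y; rewrite ?inE //.
apply/bigcupP; exists z; rewrite ?inE // wS E andbT /=.
by apply: contraNneq ws => ->.
Qed.

(** The relation between a vertex with its label and a later vertex; the label
    of the second pair is ignored, so the last label of a sequence is arbitrary. *)
Definition determines (a b : T * K) :=
  (a.1 != b.1) && (c [set a.1; b.1] == a.2).

Lemma determined_color s x y : pairwise determines s ->
  x \in map fst s -> y \in map fst s -> x != y -> c [set x; y] \in map snd s.
Proof.
elim: s => //= -[w i] s IH /andP[/allP ws ds]; rewrite !inE.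
case/predU1P=> [-> | xs]; case/predU1P=> [-> | ys]; first by rewrite eqxx.
- by case/mapP: ys => b /ws/andP[_ /eqP/= E] -> _; rewrite E eqxx.
- by case/mapP: xs => b /ws/andP[_ /eqP/= E] -> _; rewrite setUC E eqxx.
- by move=> xy; rewrite IH ?orbT.
Qed.

(** Inside the tail only labels of the tail occur as colors, and they differ from
    the label of the head, which is the color from the head to the tail. *)
Lemma determined_fresh s :
  pairwise determines s -> uniq (map snd s) -> fresh (map fst s).
Proof.
elim: s => //= -[w i] s IH /andP[/allP ws ds] /andP[/= is_ us]; split.
- by apply/mapP => -[b /ws/andP[/= /eqP]].
- exact: IH.
move=> _ y z /mapP[b /ws/andP[_ /eqP/= E] ->] ys zs yz; rewrite E.
by apply: contraNneq is_ => ->; apply: determined_color.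
Qed.

Lemma determined_mono s i : pairwise determines s ->
  all (pred1 i) (map snd s) -> monochromatic (map fst s).
Proof.
move=> ds /allP si; exists i => x y xs ys xy.
by apply/eqP; apply: (si (c _)); apply: determined_color.
Qed.

Lemma determined_uniq s : pairwise determines s -> uniq (map fst s).
Proof.
rewrite uniq_pairwise pairwise_map; apply: sub_pairwise => a b /=.
by case/andP.
Qed.

End Ramsey.

(** * Monochromatic or star-colored cliques *)

Lemma distinct_labels (T K : eqType) (s : seq (T * K)) :
  exists2 s', subseq s' s & map snd s' = undup (map snd s).
Proof.
elim: s => [|a s [s' s's E]]; first by exists [::].
rewrite /=; case: ifP => _; first exists s' => //.
  exact: subseq_trans s's (subseq_cons _ _).
by exists (a :: s') => /=; rewrite ?eqxx ?E.
Qed.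

(** Induction on [t], with [d] the bound for [t]: either some color degree reaches
    [d], and its vertex is put in front of what the neighborhood provides, or all
    color degrees are below [d] and the greedy construction applies. *)
Lemma fresh_or_determined p t : exists N, forall (T : finType) (K : eqType)
    (c : {set T} -> K) (S : {set T}), N <= #|S| ->
  (exists s, [/\ size s = p, {subset s <= S} & fresh c s]) \/
  (exists s, [/\ size s = t, {subset map fst s <= S} & pairwise (determines c) s]).
Proof.
elim: t => [|t [d IH]]; first by exists 0 => T K c S _; right; exists [::].
exists (p + p ^ 3 * d).+1 => T K c S dS.
pose nb v i := [set w in S | (w != v) && (c [set w; v] == i)].
have [[v [i [vS dvi]]] | small] := pselect (exists v i, v \in S /\ d <= #|nb v i|).
  have nbS w : w \in nb v i -> w \in S by rewrite inE => /andP[].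
  have [[s [sp sS fs]] | [s [st sS ds]]] := IH T K c _ dvi.
    by left; exists s; split=> // x /sS/nbS.
  right; exists ((v, i) :: s); split; first by rewrite /= st.
    by move=> x; rewrite inE => /predU1P[-> | /sS/nbS].
  rewrite /= ds andbT; apply/allP => b /(map_f fst)/sS.
  by rewrite inE /determines setUC eq_sym => /andP[].
left; apply: (@greedy_fresh _ _ _ _ d); last exact: ltnW.
move=> v i vS; rewrite leqNgt; apply/negP => /ltnW dvi.
by apply: small; exists v, i.
Qed.

(** A sequence of p^2 labeled vertices with determined colors contains p vertices
    with a common label or p vertices with distinct labels. *)
Lemma monochromatic_or_fresh p : exists N, forall (T : finType) (K : eqType)
    (c : {set T} -> K), N <= #|T| ->
  exists s, [/\ size s = p, uniq s & monochromatic c s \/ fresh c s].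
Proof.
have [N NP] := fresh_or_determined p (p * p); exists N => T K c.
rewrite -cardsT => /(NP _ _ c)[[s [sp _ fs]] | [s [sp _ ds]]].
  by exists s; rewrite (fresh_uniq fs); split=> //; right.
have [[i ip] | few] := pselect (exists i, p <= count_mem i (map snd s)).
  pose s1 := [seq a <- s | a.2 == i].
  have ds1 : pairwise (determines c) s1 by apply: pairwise_filter.
  have mono_s1 : monochromatic c (map fst s1).
    by apply: (determined_mono (i := i)) ds1 _; rewrite all_map; apply: filter_all.
  exists (take p (map fst s1)); split.
  - by rewrite size_takel // size_map size_filter -(count_map snd (pred1 i)).
  - by rewrite take_uniq // (determined_uniq ds1).
  left; have [j sj] := mono_s1; exists j => x y /mem_take xs /mem_take ys; exact: sj.
have [s1 s1s s1E] := distinct_labels s.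
have ds1 := subseq_pairwise s1s ds.
have us1 : uniq (map snd s1) by rewrite s1E undup_uniq.
exists (take p (map fst s1)); split.
- rewrite size_takel // size_map -(size_map snd) s1E.
  have [-> // | p0] := posnP p; rewrite -(leq_pmul2r p0) -sp -(size_map snd).
  apply: size_undup_count => i _; rewrite leqNgt; apply/negP => /ltnW ip.
  by apply: few; exists i.
- by rewrite take_uniq // (determined_uniq ds1).
- by right; apply/fresh_take/determined_fresh.
Qed.

(** * Stars and graphs spanned by edges *)

Lemma star_center (G : sgraph) (w y : G) : y != w ->
  (forall x z : G, adj x z = ((x == w) != (z == w))) -> is_star G.
Proof.
move=> yw wG; pose A := [set~ w]; have yA : y \in A by rewrite !inE.
exists #|A|; first by apply/card_gt0P; exists y.
pose g x : 'I_1 + 'I_#|A| :=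
  if x == w then inl ord0 else inr (enum_rank_in yA x).
exists g; last by move=> x z; rewrite wG /g; do 2!case: eqP.
exists (fun u => if u is inr j then enum_val j else w) => [x | [j | j]].
- by rewrite /g; case: eqVneq => // xw; rewrite enum_rankK_in ?inE.
- by rewrite /g eqxx (ord1 j).
rewrite /g; have := enum_valP j; rewrite !inE => /negPf->.
by rewrite enum_valK_in.
Qed.

Lemma is_complete_iso G H : isomorphic G H -> is_complete G -> is_complete H.
Proof.
case=> g [g' gK g'K] gE Gc x y xy.
by rewrite -(g'K x) -(g'K y) gE Gc ?(can_eq g'K).
Qed.

Lemma is_star_iso G H : isomorphic G H -> is_star G -> is_star H.
Proof.
move=> GH [r r0 Gr]; exists r => //.
exact: isomorphic_trans (isomorphic_sym GH) Gr.
Qed.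

Section Span.
Variables (V : finType) (E : {set {set V}}).
Hypothesis E2 : forall e, e \in E -> exists u v, u != v /\ e = [set u; v].

Lemma other_end e x : e \in E -> x \in e -> exists2 y, y != x & e = [set x; y].
Proof.
move=> /E2[u [v [uv ->]]]; rewrite !inE => /orP[]/eqP->; [exists v | exists u] => //.
  by rewrite eq_sym.
by rewrite setUC.
Qed.

Lemma span_no_isolated : no_isolated (span E).
Proof.
move=> [x xE]; have /bigcupP[e eE xe] := xE.
have [y yx Ee] := other_end eE xe.
have yE : y \in cover E by apply/bigcupP; exists e; rewrite // Ee !inE eqxx orbT.
by exists (Sub y yE); rewrite /= eq_sym yx -Ee.
Qed.

(** If all edges contain [w], every other covered vertex lies on an edge with
    [w], and no edge joins two vertices other than [w]. *)
Lemma span_star w : E != set0 -> (forall e, e \in E -> w \in e) -> is_star (span E).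
Proof.
case/set0Pn=> e0 e0E wE.
have wc : w \in cover E by apply/bigcupP; exists e0; rewrite ?wE.
have [z] := span_no_isolated (Sub w wc); rewrite /= => /andP[zw _].
have wedge x : x \in cover E -> x != w -> [set w; x] \in E.
  case/bigcupP=> e eE xe xw; have [y _ Ee] := other_end eE (wE e eE).
  by move: xe; rewrite Ee !inE (negPf xw) /= => /eqP->; rewrite -Ee.
apply: (@star_center (span E) (Sub w wc) z).
  by apply: contraNneq zw => ->.
move=> [x xE] [y yE]; rewrite -!val_eqE /=.
have [-> | xw] := eqVneq x w; have [-> | yw] := eqVneq y w; rewrite ?eqxx //=.
- exact: wedge.
- by rewrite xw setUC wedge.
- apply/negP => /andP[_ /wE]; rewrite !inE.
  by rewrite ![w == _]eq_sym (negPf xw) (negPf yw).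
Qed.

End Span.

(** * Color classes of a copy of K_p *)

Lemma copy_completeP n p (phi : complete p -> complete n) e :
  reflect (exists x y, x != y /\ e = [set phi x; phi y]) (e \in copy_edges phi).
Proof.
apply: (iffP imsetP) => [[_ /imsetP[[x y]] /[!inE]/= xy -> ->] | [x [y [xy ->]]]].
  by exists x, y; rewrite imsetU1 imset_set1.
exists [set x; y]; last by rewrite imsetU1 imset_set1.
by apply/imsetP; exists (x, y); rewrite ?inE.
Qed.

Lemma fresh_class_star n p (c : coloring n) (t : p.-tuple (complete n)) i :
  let phi : complete p -> complete n := tnth t in
  injective phi -> fresh c t -> i \in colors_on c (copy_edges phi) ->
  is_star (color_class c (copy_edges phi) i).
Proof.
move=> phi inj fs; rewrite mem_undup => /mapP[e]; rewrite mem_enum => eE ->.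
have [|w _ wP] := fresh_centered (c e) _ fs.
  have [x _] := copy_completeP _ _ eE; rewrite size_tuple.
  exact: leq_ltn_trans (leq0n x) (ltn_ord x).
apply: (@span_star _ _ _ w).
- move=> _ /setIdP[/copy_completeP[x [y [xy ->]]] _].
  by exists (phi x), (phi y); rewrite (inj_eq inj).
- by apply/set0Pn; exists e; rewrite inE eE /=.
move=> _ /setIdP[/copy_completeP[x [y [xy ->]]] /eqP cE]; rewrite !inE.
have [||||->|->] := wP (phi x) (phi y); rewrite ?mem_tnth ?(inj_eq inj) ?eqxx ?orbT //.
Qed.

(** The class contains an edge of the copy, so the copy has at least two
    vertices; hence each of them is an end of an edge and is covered. *)
Lemma monochromatic_class_complete n p (c : coloring n) (t : p.-tuple (complete n)) i :
  let phi : complete p -> complete n := tnth t in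
  injective phi -> monochromatic c t -> i \in colors_on c (copy_edges phi) ->
  is_complete (color_class c (copy_edges phi) i) /\
  p <= #|color_class c (copy_edges phi) i|.
Proof.
move=> phi inj [j cj]; rewrite mem_undup => /mapP[e]; rewrite mem_enum => eE ->.
rewrite /color_class; set E := [set e0 in _ | _].
have edge x y : x != y -> [set phi x; phi y] \in E.
  move=> xy; rewrite inE; apply/andP; split.
    by apply/copy_completeP; exists x, y.
  have col u v : u != v -> c [set phi u; phi v] = j.
    by move=> uv; apply: cj; rewrite ?mem_tnth ?(inj_eq inj).
  by have [u [v [uv ->]]] := copy_completeP _ _ eE; rewrite !col.
have phi_onto u : u \in cover E -> exists x, u = phi x.
  case/bigcupP=> _ /setIdP[/copy_completeP[x [y [_ ->]]] _].
  by rewrite !inE => /orP[]/eqP->; [exists x | exists y].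
split.
  move=> [u uE] [v vE]; rewrite -val_eqE /= => uv.
  have [[x ux] [y vy]] := (phi_onto u uE, phi_onto v vE).
  by rewrite uv ux vy edge // -(inj_eq inj) -ux -vy.
have phiE x : phi x \in cover E.
  have [u [v [uv _]]] := copy_completeP _ _ eE.
  have [y xy] : exists y, x != y by have [->|] := eqVneq x u; [exists v | exists u].
  by apply/bigcupP; exists [set phi x; phi y]; rewrite ?edge ?inE ?eqxx.
rewrite -{1}[p]card_ord /= card_sig -(card_imset _ inj).
by apply/subset_leq_card/subsetP => _ /imsetP[x _ ->]; exact: phiE.
Qed.

(** * Avoiding a color class isomorphic to G *)

Theorem theorem6p2 :
  forall p : nat, exists N : nat, forall G : sgraph,
    no_isolated G -> ~ is_star G ->
    (~ is_complete G /\ #|G| <= p) \/ (is_complete G /\ #|G| < p) ->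
    forall n : nat, N <= n -> f n (complete p) (all_but G) = 1.
Proof.
move=> p; have [N NP] := monochromatic_or_fresh p.
exists N => G _ Gstar Gp n Nn; rewrite /f; case: ex_minnP => m /andP[m0 _] mmin.
(* The least value 1 means that every coloring has a good copy. *)
apply/eqP; rewrite eqn_leq m0 andbT; apply: mmin; apply/asboolP => c _.
have [|s [sp us cs]] := NP _ _ c; first by rewrite card_ord.
move/eqP in sp; pose t := Tuple sp; pose phi : complete p -> complete n := tnth t.
have inj : injective phi by apply/tuple_uniqP.
exists phi => // i ic; split.
  apply: span_no_isolated => _ /setIdP[/copy_completeP[x [y [xy ->]]] _].
  by exists (phi x), (phi y); rewrite (inj_eq inj).
move=> iso; case: cs => [mono_t | fresh_t]; last first.
  exact/Gstar/(is_star_iso iso)/(@fresh_class_star n p c t).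
have [cc cp] := @monochromatic_class_complete n p c t i inj mono_t ic.
have [g gB _] := iso; have Gc := is_complete_iso iso cc.
case: Gp => [[] // | [_]]; rewrite -(bij_eq_card gB) ltnNge => /negP; exact.
Qed.
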